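(* Let $\beta\ge 0$ and suppose the regularity conditions (stated in the context) hold. Then the $\beta$-optimal auction mechanism (defined in the context) preserves the incentive compatibility and the individual rationality properties of the optimal multi-unit auction introduced by Branco. That is, the $\beta$-optimal auction, like Branco's auction, is incentive compatible (each bidder's bidding problem is solved by bidding his true type, $b_i^*=\alpha_i$ for every bidder $i$) and individually rational (a bidder who bids truthfully obtains a nonnegative payoff).
   Context: Setting. A single seller (a primary operator) has $K\ge 1$ identical channels and faces $N$ bidders (secondary operators) $i\in\{1,\dots,N\}$. Bidder $i$ has a private type $\alpha_i\in\mathcal A=(0,A_{\max})$. The types are mutually independent and drawn from the same distribution function $F$ with finite density $f$ on $\mathcal A$. A bidder of type $a$ values the $k$-th channel he receives at $U_k(a)$, where each $U_k$ is positive, monotonically increasing and differentiable in $a$, and $U_1(a)\ge U_2(a)\ge\dots\ge U_K(a)\ge 0$ for all $a\in\mathcal A$. The seller values the $k$-th channel he keeps for himself at $V_k(p)$, where $p$ is his own type and $V_1(p)\ge\dots\ge V_K(p)\ge 0$. The seller knows the functions $U_k$ and the distribution $F$ but not the types. Each bidder $i$ submits a bid $b_i\in\mathcal A$ to declare his type; $b_{-i}$ denotes the bids of the other bidders. Branco's auction. The optimal multi-unit auction of F. Branco (''Multiple unit auctions of an indivisible good'', Economic Theory 8, 1996) maximizes the seller's expected revenue. In the regular case it assigns items to the highest contributions $$\pi_k(b_i)=U_k(b_i)-U_k'(b_i)\,\frac{1-F(b_i)}{f(b_i)} .$$ The regularity conditions are that the contributions $\pi_k(a)$ are strictly increasing in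 the type $a$ and decreasing in the channel index $k$. The $\beta$-optimal auction. Its seller's objective is the sum of his valuation for the channels he keeps, his revenue from the bidders, and $\beta$ times the bidders' total valuation of the channels they receive. Define the $\beta$-contributions $$\pi_k^\beta(b_i)=(1+\beta)U_k(b_i)-U_k'(b_i)\,\frac{1-F(b_i)}{f(b_i)} .$$ Allocation rule. The seller computes $\pi_k^\beta(b_i)$ for all bidders $i$ and all $k=1,\dots,K$, compares them with his own valuations $V_k(p)$, and arranges these numbers in decreasing order, $x^\beta_{(1)}>x^\beta_{(2)}>\cdots$. The $K$ channels go to the $K$ highest entries: if $x^\beta_{(l)}=\pi_k^\beta(b_i)$ with $l\le K$, a channel is assigned to bidder $i$; if $x^\beta_{(l)}=V_k(p)$ with $l\le K$, the seller reserves a channel for himself. Let $K_i^\beta(b_i,b_{-i})$ be the number of channels bidder $i$ receives. Payment rule. The minimum bid that bidder $i$ needs to submit in order to acquire the $k$-th channel is $$z_k^\beta(b_{-i})=\inf\{\hat\alpha_i\in\mathcal A:\ \pi_k^\beta(\hat\alpha_i)\ge\max\{0,\,x^\beta_{(K+1)}\}\},$$ and the total payment of bidder $i$ is $$h^\beta(b_i,b_{-i})=\sum_{k=1}^{K_i^\beta(b_i,b_{-i})}U_k\big(z_k^\beta(b_{-i})\big).$$ Bidding problem. Bidder $i$ selects his bid to maximize his payoff: $$b_i^*=\arg\max_{b_i}\Big\{\sum_{k=1}^{K_i^\beta(b_i,b_{-i})}U_k(\alpha_i)-h^\beta(b_i,b_{-i})\Big\}.$$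
   Formalization: In the payment rule, x_(K+1) is replaced for the k-th channel by the (K+1-k)-th highest number among the other bidders' contributions and the seller's values, since the literal formula depends on b_i and breaks incentive compatibility; U_k at 0 is its right limit. *)

(* Defs.v *)
(* MathComp / MathComp-Analysis *)
From HB Require Import structures.
From mathcomp Require Export all_boot all_order all_algebra.
From mathcomp Require Export all_classical all_reals all_analysis.
Export Order.TTheory GRing.Theory Num.Theory.
Export numFieldNormedType.Exports.

Set Implicit Arguments.
Unset Strict Implicit.
Unset Printing Implicit Defensive.

Local Open Scope classical_set_scope.
Local Open Scope ring_scope.

Definition type_space (R : realType) (Amax : R) : set R :=
  [set a | 0 < a < Amax].

Definition mutually_independent (d : measure_display) (T : measurableType d)
    (R : realType) (P : probability T R) (N : nat)
    (X : 'I_N -> {RV P >-> R}) : Prop :=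
  forall (J : {set 'I_N}) (B : 'I_N -> set R),
    (forall j, measurable (B j)) ->
    P (\bigcap_(j in [set j | j \in J]) (X j @^-1` B j)) =
    (\prod_(j in J) P (X j @^-1` B j))%E.

(* The quotient (1 - F) / f in the contributions requires f to have no zero on
   the type space; this is part of the notion of density used here. *)
Record iid_types (d : measure_display) (T : measurableType d) (R : realType)
    (P : probability T R) (N : nat) (Amax : R) (F f : R -> R)
    (alpha : 'I_N -> {RV P >-> R}) : Prop := IidTypes {
  types_in_space : forall i w, type_space Amax (alpha i w);
  types_independent : mutually_independent alpha;
  types_cdf : forall i a, cdf (alpha i) a = (F a)%:E;
  density_measurable : measurable_fun (type_space Amax) f;
  density_gt0 : forall a, type_space Amax a -> 0 < f a;
  density_cdf : forall a, type_space Amax a ->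
    (F a)%:E = (\int[lebesgue_measure]_(x in `]0%R, a]) (f x)%:E)%E
}.

(* Channels are numbered from 0: [U k] and [V k] are the valuations of the
   (k+1)-st channel. *)
Record bidder_valuations (R : realType) (K : nat) (Amax : R)
    (U : 'I_K -> R -> R) : Prop := BidderValuations {
  U_gt0 : forall k a, type_space Amax a -> 0 < U k a;
  U_increasing : forall k a b, type_space Amax a -> type_space Amax b ->
    a <= b -> U k a <= U k b;
  U_derivable : forall k a, type_space Amax a -> derivable (U k) a 1;
  U_decreasing_channel : forall (k l : 'I_K) a, type_space Amax a ->
    (k <= l)%N -> U l a <= U k a
}.

Record seller_valuations (R : realType) (K : nat) (v : 'I_K -> R) : Prop :=
  SellerValuations {
  V_ge0 : forall k, 0 <= v k;
  V_decreasing_channel : forall k l : 'I_K, (k <= l)%N -> v l <= v k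
}.

Definition contribution (R : realType) (K : nat) (U : 'I_K -> R -> R)
    (F f : R -> R) (k : 'I_K) (a : R) : R :=
  U k a - derive1 (U k) a * ((1 - F a) / f a).

Definition beta_contribution (R : realType) (K : nat) (beta : R)
    (U : 'I_K -> R -> R) (F f : R -> R) (k : 'I_K) (a : R) : R :=
  (1 + beta) * U k a - derive1 (U k) a * ((1 - F a) / f a).

Definition regular (R : realType) (K : nat) (Amax : R)
    (U : 'I_K -> R -> R) (F f : R -> R) : Prop :=
  (forall k a b, type_space Amax a -> type_space Amax b -> a < b ->
     contribution U F f k a < contribution U F f k b) /\
  (forall (k l : 'I_K) a, type_space Amax a -> (k <= l)%N ->
     contribution U F f l a <= contribution U F f k a).

(* [score k a] is the contribution of a bid [a] for channel [k], [reserve k]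
   the number with which the seller competes for channel [k]. *)
Record auction (R : realType) (K : nat) := Auction {
  max_type : R;
  valuation : 'I_K -> R -> R;
  score : 'I_K -> R -> R;
  reserve : 'I_K -> R
}.

(* Branco's auction maximizes revenue alone: a kept item is worth 0. *)
Definition branco_auction (R : realType) (K : nat) (Amax : R)
    (U : 'I_K -> R -> R) (F f : R -> R) : auction R K :=
  Auction Amax U (contribution U F f) (fun=> 0).

Definition beta_auction (R : realType) (K : nat) (beta Amax : R)
    (U : 'I_K -> R -> R) (F f : R -> R) (V : 'I_K -> R -> R) (p : R) :
    auction R K :=
  Auction Amax U (beta_contribution beta U F f) (fun k => V k p).

(* [(Some i, k)] stands for the contribution of bidder [i] for channel [k],
   [(None, k)] for the seller's own valuation of channel [k]. *)
Definition entry (N K : nat) := (option 'I_N * 'I_K)%type.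

Definition entry_value (R : realType) (N K : nat) (M : auction R K)
    (b : 'I_N -> R) (e : entry N K) : R :=
  if e.1 is Some i then score M e.2 (b i) else reserve M e.2.

Definition bid_profile (R : realType) (N K : nat) (M : auction R K)
    (b : 'I_N -> R) : Prop :=
  forall j, type_space (max_type M) (b j).

(* A rule listing the entries in decreasing order of value; the only freedom is
   the way ties are broken, which may depend on the whole bid profile. *)
Definition arrangement_rule (R : realType) (N K : nat) (M : auction R K)
    (arr : ('I_N -> R) -> seq (entry N K)) : Prop :=
  forall b, bid_profile M b ->
    perm_eq (arr b) (enum {: entry N K}) /\
    sorted (fun e e' => entry_value M b e' <= entry_value M b e) (arr b).

Definition channels_won (R : realType) (N K : nat)
    (arr : ('I_N -> R) -> seq (entry N K)) (b : 'I_N -> R) (i : 'I_N) : nat :=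
  count (fun e : entry N K => e.1 == Some i) (take K (arr b)).

(* The l-th highest number of [s], for l >= 1. *)
Definition highest (R : realType) (s : seq R) (l : nat) : R :=
  nth 0 (sort >=%R s) l.-1.

Definition rival_values (R : realType) (N K : nat) (M : auction R K)
    (b : 'I_N -> R) (i : 'I_N) : seq R :=
  [seq entry_value M b e | e <- enum {: entry N K} & e.1 != Some i].

(* The minimum bid with which bidder [i] acquires his m-th channel, m = k+1.
   The number x_(K+1) he has to reach is the first one left without a channel
   once m of the K channels are his, i.e. the (K+1-m)-th = (K-k)-th highest
   number among his rivals (the other bidders and the seller).  In particular
   it does not depend on the bid of [i] himself. *)
Definition min_winning_bid (R : realType) (N K : nat) (M : auction R K)
    (b : 'I_N -> R) (i : 'I_N) (k : 'I_K) : R :=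
  inf [set a | type_space (max_type M) a /\
    Num.max 0 (highest (rival_values M b i) (K - k)) <= score M k a].

(* The infimum defining a minimum bid may be 0, which is not a type; there the
   valuation is extended by its right limit. *)
Definition closed_valuation (R : realType) (u : R -> R) (z : R) : R :=
  if 0 < z then u z else lim (u x @[x --> 0^'+]).

Definition payment (R : realType) (N K : nat) (M : auction R K)
    (arr : ('I_N -> R) -> seq (entry N K)) (b : 'I_N -> R) (i : 'I_N) : R :=
  \sum_(k < K | (k < channels_won arr b i)%N)
    closed_valuation (valuation M k) (min_winning_bid M b i k).

Definition payoff (R : realType) (N K : nat) (M : auction R K)
    (arr : ('I_N -> R) -> seq (entry N K)) (b : 'I_N -> R) (i : 'I_N)
    (a : R) : R :=
  \sum_(k < K | (k < channels_won arr b i)%N) valuation M k a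
  - payment M arr b i.

Definition with_bid (R : realType) (N : nat) (b : 'I_N -> R) (i : 'I_N)
    (x : R) : 'I_N -> R :=
  fun j => if j == i then x else b j.

(* [x] is a maximizer of the bidding problem of bidder [i] with type [a]
   facing the bids [b j], j != i. *)
Definition optimal_bid (R : realType) (N K : nat) (M : auction R K)
    (arr : ('I_N -> R) -> seq (entry N K)) (b : 'I_N -> R) (i : 'I_N)
    (a x : R) : Prop :=
  type_space (max_type M) x /\
  forall y, type_space (max_type M) y ->
    payoff M arr (with_bid b i y) i a <= payoff M arr (with_bid b i x) i a.

Definition incentive_compatible (R : realType) (N K : nat)
    (M : auction R K) : Prop :=
  forall arr : ('I_N -> R) -> seq (entry N K), arrangement_rule M arr ->
  forall (b : 'I_N -> R) (i : 'I_N) (a : R),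
    bid_profile M b -> type_space (max_type M) a ->
    optimal_bid M arr b i a a.

Definition individually_rational (R : realType) (N K : nat)
    (M : auction R K) : Prop :=
  forall arr : ('I_N -> R) -> seq (entry N K), arrangement_rule M arr ->
  forall (b : 'I_N -> R) (i : 'I_N) (a : R),
    bid_profile M b -> type_space (max_type M) a ->
    0 <= payoff M arr (with_bid b i a) i a.

(* Main.v *)
(* For channel k, bidder i faces a threshold, the (K-k)-th highest number among
   his rivals, which his own bid does not affect.  Since contributions decrease
   in the channel index, he wins channel k if his contribution exceeds this
   threshold, and loses it if his contribution is below; since contributions
   increase strictly in the bid, his price for channel k is then at most his
   valuation at his true type whenever a truthful bid wins the channel, and at
   least that valuation whenever another bid wins it but a truthful bid does
   not.  So the truthful bid maximizes the payoff channel by channel, with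
   nonnegative terms.  Adding beta * U_k, which is nondecreasing in the type
   and decreasing in k, keeps the contributions regular. *)
Require Import Defs.
From mathcomp Require Import zify.

Set Implicit Arguments.
Unset Strict Implicit.
Unset Printing Implicit Defensive.

Local Open Scope classical_set_scope.
Local Open Scope ring_scope.

(** These conditions cover both auctions at once: incentive compatibility and individual rationality
    are derived from them, and each auction is then shown to satisfy them. *)
Record regular_auction (R : realType) (K : nat) (M : auction R K) : Prop :=
  RegularAuction {
  regular_valuation : bidder_valuations (max_type M) (valuation M);
  score_increasing : forall k a b, type_space (max_type M) a ->
    type_space (max_type M) b -> a < b -> score M k a < score M k b;
  score_decreasing_channel : forall (k l : 'I_K) a,
    type_space (max_type M) a -> (k <= l)%N -> score M l a <= score M k a;
  reserve_ge0 : forall k, 0 <= reserve M k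
}.

(** * Combinatorics of sorted lists and of lists of entries *)

Lemma take_ge_drop (R : realType) (T : eqType) (v : T -> R) (s : seq T)
    (n : nat) :
  sorted (fun e e' => v e' <= v e) s ->
  {in take n s & drop n s, forall e e', v e' <= v e}.
Proof.
move=> ss; apply/allrelP; move: ss.
rewrite sorted_pairwise; last by move=> y x z /= h1 h2; exact: le_trans h2 h1.
by rewrite -{1}(cat_take_drop n s) pairwise_cat => /and3P[].
Qed.

Lemma uniq_own_channels (N K : nat) (t : seq (entry N K)) (i : 'I_N) :
  uniq t -> uniq [seq val e.2 | e <- t & e.1 == Some i].
Proof.
move=> ut; rewrite map_inj_in_uniq ?filter_uniq// => -[j k] [j' k'].
by rewrite !mem_filter /= => /andP[/eqP-> _] /andP[/eqP-> _] /val_inj ->.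
Qed.

Lemma mem_own_channels (N K : nat) (t : seq (entry N K)) (i : 'I_N)
    (k : 'I_K) :
  (val k \in [seq val e.2 | e <- t & e.1 == Some i]) = ((Some i, k) \in t).
Proof.
apply/mapP/idP => [[[j l]]|kt].
  by rewrite mem_filter /= => /andP[/eqP-> lt] /val_inj ->.
by exists (Some i, k) => //; rewrite mem_filter eqxx.
Qed.

(** Pigeonhole: more than [k] distinct channel numbers cannot all lie below [k]. Ties may rank a
    later channel of [i] before channel [k], so [l] cannot be taken equal to [k]. *)
Lemma exists_own_ge (N K : nat) (t : seq (entry N K)) (i : 'I_N) (k : nat) :
  uniq t -> (k < count (fun e : entry N K => e.1 == Some i) t)%N ->
  exists2 l : 'I_K, (k <= l)%N & (Some i, l) \in t.
Proof.
move=> ut kc; set s := [seq val e.2 | e <- t & e.1 == Some i].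
have szs : size s = count (fun e : entry N K => e.1 == Some i) t.
  by rewrite size_map size_filter.
have [/hasP[m ms km]|/hasPn sk] := boolP (has (leq k) s).
  have /mapP[[j l]] := ms; rewrite mem_filter /= => /andP[/eqP-> lt] ml.
  by exists l => //; rewrite -ml.
suff : (size s <= size (iota 0 k))%N by rewrite size_iota szs leqNgt kc.
apply: uniq_leq_size; first exact: uniq_own_channels.
by move=> m /sk; rewrite -ltnNge mem_iota.
Qed.

(** Converse count: if [t] held the entries of [i] for all of the channels 0 to [k], it would
    contain at least [k.+1] of his entries. *)
Lemma exists_own_notin (N K : nat) (t : seq (entry N K)) (i : 'I_N)
    (k : 'I_K) :
  (count (fun e : entry N K => e.1 == Some i) t <= k)%N ->
  exists2 l : 'I_K, (l <= k)%N & (Some i, l) \notin t.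
Proof.
move=> ck; apply: contrapT => nex.
suff : (k < count (fun e : entry N K => e.1 == Some i) t)%N by lia.
have <- : size [seq val e.2 | e <- t & e.1 == Some i]
    = count (fun e : entry N K => e.1 == Some i) t.
  by rewrite size_map size_filter.
rewrite -[X in (X <= _)%N](size_iota 0 k.+1).
apply: uniq_leq_size; first exact: iota_uniq.
move=> m; rewrite mem_iota add0n ltnS => /andP[_ mk].
pose l := Ordinal (leq_ltn_trans mk (ltn_ord k)).
rewrite -[m]/(val l) mem_own_channels; apply: contrapT => /negP lt.
by apply: nex; exists l.
Qed.

(** The [K] entries of the seller together with one of bidder [i] are too many for [t]. A seller
    entry left out of the winners will bound every winning score below by 0. *)
Lemma exists_reserve_notin (N K : nat) (t : seq (entry N K)) (i : 'I_N)
    (l : 'I_K) :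
  (size t <= K)%N -> (Some i, l) \in t -> exists m : 'I_K, (None, m) \notin t.
Proof.
move=> tK lt; apply: contrapT => nex.
have : (size ((Some i, l) :: [seq (None, m) : entry N K | m <- enum 'I_K])
    <= size t)%N.
  apply: uniq_leq_size.
    rewrite cons_uniq map_inj_uniq ?enum_uniq ?andbT; last by move=> m m' [].
    by apply/mapP => -[].
  move=> e; rewrite inE => /orP[/eqP->//|/mapP[m _ ->]].
  by apply: contrapT => /negP mt; apply: nex; exists m.
by rewrite /= size_map size_enum_ord; lia.
Qed.

(** * Winning entries and the threshold set by the rivals *)

Lemma arr_uniq (R : realType) (N K : nat) (M : auction R K)
    (arr : ('I_N -> R) -> seq (entry N K)) (b : 'I_N -> R) :
  arrangement_rule M arr -> bid_profile M b -> uniq (arr b).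
Proof. by move=> arrM /arrM[/perm_uniq-> _]; exact: enum_uniq. Qed.

Lemma mem_arr (R : realType) (N K : nat) (M : auction R K)
    (arr : ('I_N -> R) -> seq (entry N K)) (b : 'I_N -> R) :
  arrangement_rule M arr -> bid_profile M b -> arr b =i predT.
Proof. by move=> arrM /arrM[/perm_mem arrE _] e; rewrite arrE mem_enum. Qed.

Lemma notin_winners (R : realType) (N K : nat) (M : auction R K)
    (arr : ('I_N -> R) -> seq (entry N K)) (b : 'I_N -> R) (e : entry N K) :
  arrangement_rule M arr -> bid_profile M b ->
  e \notin take K (arr b) -> e \in drop K (arr b).
Proof.
move=> arrM bM /negPf eK; have := mem_arr arrM bM e.
by rewrite -{1}(cat_take_drop K (arr b)) mem_cat eK.
Qed.

Lemma size_winners (R : realType) (N K : nat) (M : auction R K)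
    (arr : ('I_N -> R) -> seq (entry N K)) (b : 'I_N -> R) :
  arrangement_rule M arr -> bid_profile M b -> size (take K (arr b)) = K.
Proof.
move=> arrM /arrM[/perm_size arrE _]; apply: size_takel.
(* There are (N + 1) K entries, and those of the seller alone already number K. *)
by rewrite arrE -cardT card_prod card_option !card_ord mulSn leq_addr.
Qed.

Lemma count_winners (R : realType) (N K : nat) (M : auction R K)
    (arr : ('I_N -> R) -> seq (entry N K)) (b : 'I_N -> R) (i : 'I_N) :
  arrangement_rule M arr -> bid_profile M b ->
  (channels_won arr b i +
   count (fun e : entry N K => e.1 != Some i) (take K (arr b)))%N = K.
Proof. by move=> arrM bM; rewrite count_predC (size_winners arrM bM). Qed.

(** Removing the entries of [i] keeps [arr b] sorted, and sorted lists of the same values coincide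
    however ties order the entries. The threshold can thus be located relative to the cut of [arr b]
    at [K]. *)
Lemma highest_rival (R : realType) (N K : nat) (M : auction R K)
    (arr : ('I_N -> R) -> seq (entry N K)) (b : 'I_N -> R) (i : 'I_N)
    (l : nat) :
  arrangement_rule M arr -> bid_profile M b ->
  highest (rival_values M b i) l =
  nth 0 [seq entry_value M b e | e <- arr b & e.1 != Some i] l.-1.
Proof.
move=> arrM bM; have [arrE arr_sorted] := arrM _ bM.
have geT : transitive (>=%R : rel R).
  by move=> y x z /= h1 h2; exact: le_trans h2 h1.
rewrite /highest; congr (nth _ _ _); apply: (sorted_eq geT).
- by move=> x y /= /andP[xy yx]; apply: le_anti; rewrite xy yx.
- by apply: sort_sorted => x y /=; exact: le_total.
- rewrite sorted_map; apply: sorted_filter => //.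
  by move=> y x z /= h1 h2; exact: le_trans h2 h1.
- by rewrite perm_sort; apply/perm_map/perm_filter; rewrite perm_sym.
Qed.

(** Some winning entry of [i] has channel at least [k], so his score for [k] dominates every losing
    entry. The threshold is the value of such an entry. *)
Lemma winning_score (R : realType) (N K : nat) (M : auction R K)
    (arr : ('I_N -> R) -> seq (entry N K)) (b : 'I_N -> R) (i : 'I_N)
    (k : 'I_K) :
  regular_auction M -> arrangement_rule M arr -> bid_profile M b ->
  (k < channels_won arr b i)%N ->
  Num.max 0 (highest (rival_values M b i) (K - k)) <= score M k (b i).
Proof.
move=> regM arrM bM kw; have szw := size_winners arrM bM.
have uw : uniq (take K (arr b)) by rewrite take_uniq ?(arr_uniq arrM bM).
have [l kl lw] := exists_own_ge uw kw.
have drop_le e : e \in drop K (arr b) -> entry_value M b e <= score M k (b i).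
  move=> eK; apply: le_trans (score_decreasing_channel regM _ kl) => //.
  have [_ arr_sorted] := arrM _ bM.
  exact: (take_ge_drop arr_sorted lw eK).
have score_ge0 : 0 <= score M k (b i).
  (* A losing entry of the seller supplies the bound by 0. *)
  have [m mw] := exists_reserve_notin (eq_leq szw) lw.
  apply: le_trans (drop_le _ (notin_winners arrM bM mw)).
  exact: reserve_ge0.
rewrite ge_max score_ge0 (highest_rival _ _ arrM bM) /=.
(* Beyond the end of the list the threshold is the default 0, already bounded by [score_ge0]. *)
have [out|inside] := leqP (size [seq entry_value M b e |
    e <- arr b & e.1 != Some i]) (K - k).-1; first by rewrite nth_default.
move: inside; rewrite -{1 2}(cat_take_drop K (arr b)) filter_cat map_cat.
rewrite nth_cat size_cat !size_map size_filter => inside.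
have cw := count_winners i arrM bM.
(* With at least [k.+1] channels going to [i], at most K - k - 1 rival entries win, so the
   zero-based index K - k - 1 falls in the losing part. *)
have kcw : (count (fun e : entry N K => e.1 != Some i) (take K (arr b))
    <= (K - k).-1)%N by lia.
rewrite ltnNge kcw /=.
set s := [seq _ | _ <- _ & _]; set m := (_ - _)%N.
have /mapP[e] : nth 0 s m \in s.
  by apply: mem_nth; rewrite /m size_map ltn_subLR.
by rewrite mem_filter => /andP[_ /drop_le ?] ->.
Qed.

(** At least K - k rival entries win, so the threshold is a winning value. It dominates a losing
    entry of [i] with channel at most [k], whose score is at least that for [k]. *)
Lemma losing_score (R : realType) (N K : nat) (M : auction R K)
    (arr : ('I_N -> R) -> seq (entry N K)) (b : 'I_N -> R) (i : 'I_N)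
    (k : 'I_K) :
  regular_auction M -> arrangement_rule M arr -> bid_profile M b ->
  (channels_won arr b i <= k)%N ->
  score M k (b i) <= Num.max 0 (highest (rival_values M b i) (K - k)).
Proof.
move=> regM arrM bM kw; have [l lk /(notin_winners arrM bM) lw] := exists_own_notin kw.
rewrite le_max (highest_rival _ _ arrM bM); apply/orP; right.
apply: le_trans (score_decreasing_channel regM (bM i) lk) _.
have [_ arr_sorted] := arrM _ bM.
rewrite -(cat_take_drop K (arr b)) filter_cat map_cat nth_cat.
rewrite size_map size_filter.
have cw := count_winners i arrM bM.
have kcw : ((K - k).-1 <
    count (fun e : entry N K => e.1 != Some i) (take K (arr b)))%N.
  (* As [k] is below [K], the predecessor of K - k is a genuine one. *)
  by have := ltn_ord k; lia.
rewrite kcw; set s := [seq _ | _ <- _ & _].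
have /mapP[e] : nth 0 s (K - k).-1 \in s.
  by apply: mem_nth; rewrite size_map size_filter.
rewrite mem_filter => /andP[_ eK] ->.
exact: (take_ge_drop arr_sorted eK lw).
Qed.

(** * Minimum winning bids when one bidder changes his bid *)

Lemma with_bid_self (R : realType) (N : nat) (b : 'I_N -> R) (i : 'I_N)
    (x : R) : with_bid b i x i = x.
Proof. by rewrite /with_bid eqxx. Qed.

Lemma with_bid_profile (R : realType) (N K : nat) (M : auction R K)
    (b : 'I_N -> R) (i : 'I_N) (x : R) :
  bid_profile M b -> type_space (max_type M) x ->
  bid_profile M (with_bid b i x).
Proof. by move=> bM xM j; rewrite /with_bid; case: ifP. Qed.

Lemma rival_values_with_bid (R : realType) (N K : nat) (M : auction R K)
    (b : 'I_N -> R) (i : 'I_N) (x : R) :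
  rival_values M (with_bid b i x) i = rival_values M b i.
Proof.
apply/eq_in_map => -[[j|] k]; rewrite mem_filter //= => /andP[ji _].
by rewrite /entry_value /= /with_bid ifN //; apply: contra ji => /eqP->.
Qed.

Lemma min_winning_bid_with_bid (R : realType) (N K : nat) (M : auction R K)
    (b : 'I_N -> R) (i : 'I_N) (x : R) (k : 'I_K) :
  min_winning_bid M (with_bid b i x) i k = min_winning_bid M b i k.
Proof. by rewrite /min_winning_bid rival_values_with_bid. Qed.

Lemma min_winning_bid_le (R : realType) (N K : nat) (M : auction R K)
    (arr : ('I_N -> R) -> seq (entry N K)) (b : 'I_N -> R) (i : 'I_N)
    (k : 'I_K) :
  regular_auction M -> arrangement_rule M arr -> bid_profile M b ->
  (k < channels_won arr b i)%N -> min_winning_bid M b i k <= b i.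
Proof.
move=> regM arrM bM kw; apply: ge_inf; last first.
  by split; [exact: bM|exact: winning_score kw].
by exists 0 => a [/andP[/ltW]].
Qed.

(** The winning bid [y] makes the set nonempty, so its infimum is not a default value. A member
    below [b i] would score strictly less than [b i], whose score does not exceed the threshold. *)
Lemma min_winning_bid_ge (R : realType) (N K : nat) (M : auction R K)
    (arr : ('I_N -> R) -> seq (entry N K)) (b : 'I_N -> R) (i : 'I_N)
    (k : 'I_K) (y : R) :
  regular_auction M -> arrangement_rule M arr -> bid_profile M b ->
  type_space (max_type M) y ->
  (channels_won arr b i <= k)%N ->
  (k < channels_won arr (with_bid b i y) i)%N ->
  b i <= min_winning_bid M b i k.
Proof.
move=> regM arrM bM yM kb ky.
have byM := with_bid_profile i bM yM.
apply: lb_le_inf.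
  exists y; split => //; have := winning_score regM arrM byM ky.
  by rewrite rival_values_with_bid with_bid_self.
move=> a [aM ta]; rewrite leNgt; apply/negP => ab.
have := score_increasing regM k aM (bM i) ab.
rewrite ltNge => /negP; apply.
exact: le_trans (losing_score regM arrM bM kb) ta.
Qed.

(** * Monotonicity of the valuation extended to 0 *)

Lemma closed_valuation_le (R : realType) (K : nat) (Amax : R)
    (U : 'I_K -> R -> R) (k : 'I_K) (z a : R) :
  bidder_valuations Amax U -> type_space Amax a -> z <= a ->
  closed_valuation (U k) z <= U k a.
Proof.
move=> UP aM za; have /andP[a0 aA] := aM.
have below x : 0 < x -> x <= a -> type_space Amax x.
  by move=> x0 xa; apply/andP; split => //; exact: le_lt_trans aA.
rewrite /closed_valuation; case: ifPn => [z0|_].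
  by apply: (U_increasing UP) => //; exact: below.
apply: limr_le.
  (* The right limit at 0 exists because [U k] is nondecreasing and bounded below by 0 on the open
     interval from 0 to [a]. *)
  apply/cvg_ex; eexists.
  apply: (@nondecreasing_at_right_cvgr _ (U k) 0 (BLeft a)).
  - by rewrite bnd_simp.
  - move=> x y; rewrite !in_itv /= => /andP[x0 xa] /andP[y0 ya].
    by apply: (U_increasing UP); apply: below => //; exact: ltW.
  - exists 0 => _ [x /= xa <-]; move: xa; rewrite in_itv /= => /andP[x0 xa].
    by apply/ltW/(U_gt0 UP)/below => //; exact: ltW.
near=> x.
have x0 : 0 < x by near: x; exact: nbhs_right_gt.
have xa : x < a by near: x; exact: nbhs_right_lt.
by apply: (U_increasing UP) => //; [apply: below => //|]; exact: ltW.
Unshelve. all: by end_near.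
Qed.

Lemma closed_valuation_ge (R : realType) (K : nat) (Amax : R)
    (U : 'I_K -> R -> R) (k : 'I_K) (z a : R) :
  bidder_valuations Amax U -> type_space Amax a -> a <= z -> z < Amax ->
  U k a <= closed_valuation (U k) z.
Proof.
move=> UP aM az zA; have /andP[a0 _] := aM.
have z0 : 0 < z by exact: lt_le_trans az.
by rewrite /closed_valuation z0 (U_increasing UP) //; apply/andP.
Qed.

(** * Payoffs and prices channel by channel *)

Lemma payoffE (R : realType) (N K : nat) (M : auction R K)
    (arr : ('I_N -> R) -> seq (entry N K)) (b : 'I_N -> R) (i : 'I_N)
    (x a : R) :
  payoff M arr (with_bid b i x) i a =
  \sum_(k < K | (k < channels_won arr (with_bid b i x) i)%N)
    (valuation M k a
     - closed_valuation (valuation M k) (min_winning_bid M b i k)).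
Proof.
rewrite /payoff /payment -sumrB; apply: eq_bigr => k _.
by rewrite min_winning_bid_with_bid.
Qed.

Lemma price_le (R : realType) (N K : nat) (M : auction R K)
    (arr : ('I_N -> R) -> seq (entry N K)) (b : 'I_N -> R) (i : 'I_N)
    (a : R) (k : 'I_K) :
  regular_auction M -> arrangement_rule M arr -> bid_profile M b ->
  type_space (max_type M) a ->
  (k < channels_won arr (with_bid b i a) i)%N ->
  closed_valuation (valuation M k) (min_winning_bid M b i k)
    <= valuation M k a.
Proof.
move=> regM arrM bM aM kw.
apply: (closed_valuation_le _ (regular_valuation regM)) => //.
rewrite -(min_winning_bid_with_bid M b i a) -[leRHS](with_bid_self b i).
exact: min_winning_bid_le (with_bid_profile i bM aM) kw.
Qed.

Lemma price_ge (R : realType) (N K : nat) (M : auction R K)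
    (arr : ('I_N -> R) -> seq (entry N K)) (b : 'I_N -> R) (i : 'I_N)
    (a y : R) (k : 'I_K) :
  regular_auction M -> arrangement_rule M arr -> bid_profile M b ->
  type_space (max_type M) a -> type_space (max_type M) y ->
  (channels_won arr (with_bid b i a) i <= k)%N ->
  (k < channels_won arr (with_bid b i y) i)%N ->
  valuation M k a
    <= closed_valuation (valuation M k) (min_winning_bid M b i k).
Proof.
move=> regM arrM bM aM yM ka ky.
have with_bidK : with_bid (with_bid b i a) i y = with_bid b i y.
  by apply/funext => j; rewrite /with_bid; case: eqP.
apply: (closed_valuation_ge _ (regular_valuation regM)) => //.
  rewrite -(min_winning_bid_with_bid M b i a) -[leLHS](with_bid_self b i).
  apply: (min_winning_bid_ge _ arrM (with_bid_profile i bM aM) yM ka) => //.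
  by rewrite with_bidK.
(* The minimum winning bid is at most the winning bid [y], hence below the largest type. *)
have /andP[_] := yM; apply: le_lt_trans.
rewrite -(min_winning_bid_with_bid M b i y) -[leRHS](with_bid_self b i).
exact: min_winning_bid_le (with_bid_profile i bM yM) ky.
Qed.

Lemma regular_individually_rational (R : realType) (N K : nat)
    (M : auction R K) : regular_auction M -> individually_rational N M.
Proof.
move=> regM arr arrM b i a bM aM; rewrite payoffE; apply: sumr_ge0 => k kw.
by rewrite subr_ge0 (price_le regM arrM).
Qed.

Lemma regular_incentive_compatible (R : realType) (N K : nat)
    (M : auction R K) : regular_auction M -> incentive_compatible N M.
Proof.
move=> regM arr arrM b i a bM aM; split => // y yM.
(* Both sums are extended by zeros to all channels, so that they can be compared termwise. *)
rewrite !payoffE big_mkcond [leRHS]big_mkcond; apply: ler_sum => k _.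
have [kw|kw] := ltnP k (channels_won arr (with_bid b i a) i).
  by case: ifP => // _; rewrite subr_ge0 (price_le regM arrM).
by case: ifP => // ky; rewrite subr_le0 (price_ge regM arrM bM aM yM).
Qed.

(** * Regularity of the two auctions *)

Lemma beta_contributionE (R : realType) (K : nat) (beta : R)
    (U : 'I_K -> R -> R) (F f : R -> R) (k : 'I_K) (a : R) :
  beta_contribution beta U F f k a = contribution U F f k a + beta * U k a.
Proof.
by rewrite /beta_contribution /contribution mulrDl mul1r addrAC.
Qed.

Lemma branco_regular (R : realType) (K : nat) (Amax : R)
    (U : 'I_K -> R -> R) (F f : R -> R) :
  bidder_valuations Amax U -> regular Amax U F f ->
  regular_auction (branco_auction Amax U F f).
Proof. by move=> UP [incr decr]; split. Qed.

Lemma beta_regular (R : realType) (K : nat) (beta Amax : R)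
    (U : 'I_K -> R -> R) (F f : R -> R) (V : 'I_K -> R -> R) (p : R) :
  0 <= beta -> bidder_valuations Amax U ->
  seller_valuations (fun k => V k p) -> regular Amax U F f ->
  regular_auction (beta_auction beta Amax U F f V p).
Proof.
move=> beta0 UP VP [incr decr]; split => //= [k a b aM bM ab|k l a aM kl|k].
- rewrite !beta_contributionE ltr_leD ?incr// ler_wpM2l//.
  by apply: (U_increasing UP) => //; exact: ltW.
- rewrite !beta_contributionE lerD ?decr// ler_wpM2l//.
  exact: (U_decreasing_channel UP).
- exact: (V_ge0 VP).
Qed.

Theorem proposition1 (R : realType) (d : measure_display)
    (T : measurableType d) (P : probability T R) (N K : nat) (Amax : R)
    (F f : R -> R) (alpha : 'I_N -> {RV P >-> R})
    (U V : 'I_K -> R -> R) (p beta : R) :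
  (1 <= K)%N -> 0 < Amax ->
  iid_types Amax F f alpha ->
  bidder_valuations Amax U ->
  seller_valuations (fun k => V k p) ->
  0 <= beta ->
  regular Amax U F f ->
  (incentive_compatible N (branco_auction Amax U F f) /\
   individually_rational N (branco_auction Amax U F f)) /\
  (incentive_compatible N (beta_auction beta Amax U F f V p) /\
   individually_rational N (beta_auction beta Amax U F f V p)).
Proof.
move=> _ _ _ UP VP beta0 reg.
have regB := branco_regular UP reg.
have regb := beta_regular beta0 UP VP reg.
by split; split; [exact: regular_incentive_compatible
  |exact: regular_individually_rational|exact: regular_incentive_compatible
  |exact: regular_individually_rational].
Qed.
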